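(* Let $X$ be an infinite metric space. (1) If $X$ is compact and uncountable, then $(\mathrm{Met}(X),\mathcal{D}_X)$ is universal for the class $\mathscr{T}$ of all totally bounded metric spaces. (2) If $X$ is non-compact, then $(\mathrm{Met}(X),\mathcal{D}_X)$ contains an isometric copy of $(\ell^\infty,\|\cdot\|_{\ell^\infty})$. In particular, $(\mathrm{Met}(X),\mathcal{D}_X)$ is universal for the class $\mathscr{S}$ of all separable metric spaces. Moreover, the space $(\mathrm{BMet}(X),\mathcal{D}_X)$ is universal for the class $\mathrm{B}(\mathscr{S})$ of all bounded separable metric spaces. As a consequence, if $X$ is non-compact, or compact and uncountable, then $(\mathrm{BMet}(X),\mathcal{D}_X)$ is universal for all compact metric spaces.
   Context: For a metrizable space $X$, $\mathrm{Met}(X)$ is the set of all metrics on $X$ that generate the given topology of $X$, and $\mathrm{BMet}(X)$ is the set of all bounded metrics in $\mathrm{Met}(X)$. The sup-metric is $\mathcal{D}_X(d,e)=\sup_{x,y\in X}|d(x,y)-e(x,y)|$ (a priori possibly taking the value $\infty$); subsets carry its restriction. $\ell^\infty$ is the space of bounded real-valued functions on $\mathbb{N}$ with the metric induced by the sup-norm $\|\cdot\|_{\ell^\infty}$. A space $(M,\rho)$ is universal for a class of metric spaces if every member of the class admits an isometric (distance-preserving) embedding into $(M,\rho)$. *)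

(* Defs.v *)
From mathcomp Require Import all_boot all_order all_algebra.
From mathcomp Require Import all_classical all_reals all_analysis.

Set Implicit Arguments.
Unset Strict Implicit.
Unset Printing Implicit Defensive.

Import Order.TTheory GRing.Theory Num.Theory.
Import numFieldNormedType.Exports.

Local Open Scope classical_set_scope.
Local Open Scope ring_scope.

Definition is_metric (R : realType) (X : Type) (d : X -> X -> R) : Prop :=
  [/\ forall x y, 0 <= d x y,
      forall x y, d x y = 0 <-> x = y,
      forall x y, d x y = d y x &
      forall x y z, d x z <= d x y + d y z].

Definition generates_topology (R : realType) (X : topologicalType)
    (d : X -> X -> R) : Prop :=
  forall A : set X, open A <->
    forall x, A x -> exists2 e : R, 0 < e & [set y | d x y < e] `<=` A.

Definition bounded_dist (R : realType) (X : Type) (d : X -> X -> R) : Prop :=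
  exists M : R, forall x y, d x y <= M.

Definition Met (R : realType) (X : topologicalType) : set (X -> X -> R) :=
  [set d | is_metric d /\ generates_topology d].

Definition BMet (R : realType) (X : topologicalType) : set (X -> X -> R) :=
  [set d | Met d /\ bounded_dist d].

Arguments Met R X : clear implicits.
Arguments BMet R X : clear implicits.

Definition sup_dist (R : realType) (X : Type) (d e : X -> X -> R) : \bar R :=
  ereal_sup (range (fun p : X * X => `|d p.1 p.2 - e p.1 p.2|%:E)).

(* Distances are taken in \bar R because sup_dist may be infinite; a subset of
   the ambient type carries the restricted distance. *)
Definition isom_embeds (R : realType) (M N : Type)
    (A : set M) (rho : M -> M -> \bar R)
    (B : set N) (sigma : N -> N -> \bar R) : Prop :=
  exists f : M -> N, (forall x, A x -> B (f x)) /\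
    (forall x y, A x -> A y -> sigma (f x) (f y) = rho x y).

Definition universal_for (R : realType) (N : Type)
    (B : set N) (sigma : N -> N -> \bar R) (C : metricType R -> Prop) : Prop :=
  forall T : metricType R, C T ->
    isom_embeds [set: T] (fun s t => (mdist s t)%:E) B sigma.

Definition linfty (R : realType) : set (nat -> R) :=
  [set u | exists M : R, forall n, `|u n| <= M].

Definition linfty_norm (R : realType) (u : nat -> R) : R :=
  sup (range (fun n => `|u n|)).

Definition linfty_dist (R : realType) (u v : nat -> R) : R :=
  linfty_norm (fun n => u n - v n).

Arguments linfty R : clear implicits.

Definition compact_space (R : realType) (T : metricType R) : Prop :=
  compact [set: T].

Definition totally_bounded_space (R : realType) (T : metricType R) : Prop :=
  forall e : R, 0 < e -> exists2 F : set T, finite_set F &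
    [set: T] `<=` \bigcup_(x in F) ball x e.

Definition separable_space (R : realType) (T : metricType R) : Prop :=
  exists2 S : set T, countable S & dense S.

Definition bounded_space (R : realType) (T : metricType R) : Prop :=
  bounded_dist (@mdist R T).

(* Main.v *)
(* All metrics are of the form min(d, 1) + P with P a continuous pseudometric.

   If X is not compact, it carries a locally finite sequence of bumps g_n, with
   a common zero, such that g_n is 1 at a_n where the other bumps vanish. The
   metrics P_w(x, y) = sup_n w_n |g_n x - g_n y| with weights w >= 0 satisfy
   D(P_w, P_w') = sup_n |w_n - w'_n|; the weights max(0, u_n + k), indexed by
   pairs (n, k), embed l^oo, and Frechet's embedding does the rest.

   If X is compact and uncountable, a Cantor scheme gives continuous functions
   g_k : X -> [0, 1] such that every binary sequence is (g_k x)_k for some x.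
   Coding the points t of a totally bounded T by binary sequences (comparison
   with finite nets) gives points p_t of X and e = sup_k c_k |g_k x - g_k y|
   with c_k -> 0 and d(s, t) <= e(p_s, p_t). McShane's extension
   F_t(x) = sup_s max(0, d(t, s) - e(x, p_s)) is then 1-Lipschitz for e, and
   P_t = max(e, |H_t x - H_t y|) with H_t = F_t + K min(1, 2 g_0) works. *)
Require Import Defs.
From mathcomp Require Import all_boot all_order all_algebra.
From mathcomp Require Import all_classical all_reals all_analysis.
From mathcomp Require Import ring lra.

Set Implicit Arguments.
Unset Strict Implicit.
Unset Printing Implicit Defensive.

Import Order.TTheory GRing.Theory Num.Theory.
Import numFieldNormedType.Exports.

Local Open Scope classical_set_scope.
Local Open Scope ring_scope.

(** * Suprema of real families, and the metrics [mdist1 + P] *)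

Section sup_range.
Context {R : realType} {I : Type}.
Implicit Types f g : I -> R.

Lemma le_sup_range f M i : (forall j, f j <= M) -> f i <= sup (range f).
Proof.
by move=> fM; apply: ub_le_sup; [exists M => _ [j _ <-] | exists i].
Qed.

Lemma sup_range_le f M (i0 : I) : (forall j, f j <= M) -> sup (range f) <= M.
Proof.
by move=> fM; apply: ge_sup; [exists (f i0), i0 | move=> _ [j _ <-]].
Qed.

Lemma sup_range_dist f g (i0 : I) Mf Mg a :
  (forall j, f j <= Mf) -> (forall j, g j <= Mg) ->
  (forall j, `|f j - g j| <= a) -> `|sup (range f) - sup (range g)| <= a.
Proof.
move=> fM gM fga; have fg j := fga j; rewrite ler_norml; apply/andP; split.
  suff : sup (range g) <= sup (range f) + a by lra.
  apply: (sup_range_le i0) => j; have := le_sup_range j fM.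
  by move: (fg j); rewrite ler_norml; lra.
suff : sup (range f) <= sup (range g) + a by lra.
apply: (sup_range_le i0) => j; have := le_sup_range j gM.
by move: (fg j); rewrite ler_norml; lra.
Qed.

End sup_range.

(** The second hypothesis asks only for approximate attainment: a supremum over sequence coordinates
    need not be attained. *)
Lemma sup_dist_fin (R : realType) (X : Type) (d e : X -> X -> R) (a : R) :
  (forall x y, `|d x y - e x y| <= a) ->
  (forall b, b < a -> exists x y, b < `|d x y - e x y|) ->
  sup_dist d e = a%:E.
Proof.
move=> dea dea'; apply/eqP; rewrite eq_le; apply/andP; split.
  by apply: ge_ereal_sup => _ [p _ <-]; rewrite lee_fin.
apply/lee_addgt0Pr => r r0.
have [x [y xy]] : exists x y, a - r < `|d x y - e x y|.
  by apply: dea'; rewrite ltrBlDr ltrDl.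
have : (`|d x y - e x y|%:E <= sup_dist d e)%E.
  by apply: ereal_sup_ubound; exists (x, y).
move=> /(leeD2r r%:E); apply: le_trans.
by rewrite -EFinD lee_fin; lra.
Qed.

(* A pseudometric continuous for the given topology: by the triangle
   inequality, continuity at the diagonal suffices. *)
Definition cont_pseudometric (R : realType) (X : topologicalType)
    (P : X -> X -> R) : Prop :=
  [/\ forall x y, 0 <= P x y, forall x, P x x = 0,
      forall x y, P x y = P y x, forall x y z, P x z <= P x y + P y z &
      forall x (e : R), 0 < e -> \forall y \near x, P x y < e].

Definition mdist1 (R : realType) (X : metricType R) (x y : X) : R :=
  Num.min (mdist x y) 1.

(** Adding [P] only shrinks balls, so open sets stay open; continuity of [P] gives the converse.
    Truncating the distance leaves boundedness to [P] alone. *)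
Lemma Met_mdist1D (R : realType) (X : metricType R) (P : X -> X -> R) :
  cont_pseudometric P -> Met R X (fun x y => mdist1 x y + P x y).
Proof.
move=> [P0 Pxx Psym Ptri Pcont].
have m0 (x y : X) : 0 <= mdist1 x y by rewrite le_min mdist_ge0 ler01.
split; first split.
- by move=> x y; rewrite addr_ge0.
- move=> x y; split=> [/eqP|->]; last first.
    by rewrite /mdist1 mdistxx Pxx addr0 min_l.
  rewrite paddr_eq0// => /andP[/eqP + _]; rewrite /mdist1 minEle.
  by case: ifP => _ => [/mdist_positivity//|/eqP]; rewrite oner_eq0.
- by move=> x y; rewrite /mdist1 metric_sym Psym.
- move=> x y z; have := Ptri x y z; have := metric_triangle x y z.
  have := mdist_ge0 x y; have := mdist_ge0 y z.
  by rewrite /mdist1; case: (leP (mdist x y) 1); case: (leP (mdist y z) 1);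
    case: (leP (mdist x z) 1); lra.
move=> A; split=> [+ x Ax|Aball].
  rewrite openE => /(_ x Ax) /nbhs_ballP[e /= e0]; rewrite ballEmdist => eA.
  exists (Num.min e 1); first by rewrite lt_min e0 ltr01.
  move=> y /= ye; apply: eA => /=; move: ye (P0 x y).
  by rewrite /mdist1; case: (leP (mdist x y) 1); case: (leP e 1); lra.
rewrite openE => x Ax; have [e e0 eA] := Aball x Ax.
have e20 : 0 < e / 2 by lra.
rewrite /interior; near=> y; apply: eA => /=.
have yP : P x y < e / 2 by near: y; exact: Pcont.
have : mdist1 x y < e / 2.
  apply: (@le_lt_trans _ _ (mdist x y)); first by rewrite ge_min lexx.
  near: y; apply/nbhs_ballP; exists (e / 2) => //= y.
  by rewrite ballEmdist.
lra.
Unshelve. all: by end_near. Qed.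

Lemma BMet_mdist1D (R : realType) (X : metricType R) (P : X -> X -> R) M :
  cont_pseudometric P -> (forall x y, P x y <= M) ->
  BMet R X (fun x y => mdist1 x y + P x y).
Proof.
move=> cP PM; split; first exact: Met_mdist1D.
by exists (1 + M) => x y; rewrite lerD// ge_min lexx orbT.
Qed.

(** * Weighted suprema of pseudometrics *)

Section sup_pseudometric.
Context {R : realType} {X : topologicalType}.
Implicit Types (c : nat -> R) (g : nat -> X -> R).

Definition sup_pm c g (x y : X) : R :=
  sup (range (fun n => c n * `|g n x - g n y|)).

Lemma cont_pseudometric_sup_pm c g :
  (forall n, 0 <= c n) -> (forall n, continuous (g n)) ->
  (forall x y, exists M, forall n, c n * `|g n x - g n y| <= M) ->
  (forall x (e : R), 0 < e -> exists N, \forall y \near x,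
     forall n, (N <= n)%N -> c n * `|g n x - g n y| <= e) ->
  cont_pseudometric (sup_pm c g).
Proof.
move=> c0 gc bnd tail.
have t0 x y n : 0 <= c n * `|g n x - g n y| by rewrite mulr_ge0.
split.
- move=> x y; have [M bM] := bnd x y.
  by apply: le_trans (t0 x y 0%N) _; apply: le_sup_range bM.
- move=> x; apply/eqP; rewrite eq_le; apply/andP; split.
    by apply: (sup_range_le 0%N) => n; rewrite subrr normr0 mulr0.
  have [M bM] := bnd x x.
  by apply: le_trans (t0 x x 0%N) _; apply: le_sup_range bM.
- by move=> x y; rewrite /sup_pm; under eq_fun do rewrite distrC.
- move=> x y z; have [M bM] := bnd x y; have [M' bM'] := bnd y z.
  apply: (sup_range_le 0%N) => n; apply: (le_trans _ (lerD (le_sup_range n bM)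
    (le_sup_range n bM'))).
  by rewrite -mulrDr ler_wpM2l// ler_distD.
move=> x e e0; have e20 : 0 < e / 2 by lra.
have [N tN] := tail x _ e20.
have : \forall y \near x, forall n, (n < N)%N -> c n * `|g n x - g n y| <= e / 2.
  elim: N {tN} => [|N IH]; first exact: nearW.
  have cN : 0 < c N + 1 by rewrite ltr_pwDr.
  near=> y => n; rewrite ltnS leq_eqVlt => /predU1P[->|]; last first.
    by move: n; near: y.
  have : `|g N x - g N y| < e / 2 / (c N + 1).
    near: y; move/cvgrPdist_lt: (gc N x); apply.
    by rewrite divr_gt0.
  rewrite ltr_pdivlMr// => h; have := normr_ge0 (g N x - g N y).
  by rewrite mulrC; move: h; rewrite mulrDr mulr1; lra.
move=> hN; near=> y; apply: (@le_lt_trans _ _ (e / 2)); last lra.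
have tNy : forall n, (N <= n)%N -> c n * `|g n x - g n y| <= e / 2 by near: y.
have hNy : forall n, (n < N)%N -> c n * `|g n x - g n y| <= e / 2 by near: y.
by apply: (sup_range_le 0%N) => n; case: (ltnP n N) => [/hNy|/tNy].
Unshelve. all: by end_near. Qed.

End sup_pseudometric.

Lemma ler_dist_maxr (R : realDomainType) (a u v : R) :
  `|Num.max a u - Num.max a v| <= `|u - v|.
Proof.
have n0 := normr_ge0 (u - v).
have /andP[n1 n2] : - `|u - v| <= u - v <= `|u - v| by rewrite -ler_norml.
by rewrite ler_norml; case: (leP a u); case: (leP a v); lra.
Qed.

(* The pair [(p s, z)] reads off [mdist t s]: the distance to [z] is a Katetov
   function [K + F t], which may depend on [t] as long as the distances between
   points near the range of [p] do not. *)
Lemma isom_embeds_BMet_coded (R : realType) (X T : metricType R)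
    (e : X -> X -> R) (q : X -> R) (K D : R) (p : T -> X) (z : X) :
  cont_pseudometric e -> (forall x y, e x y <= K) ->
  (forall s t : T, mdist s t <= D) -> 0 <= D -> 2 * D <= K ->
  (forall x y, K * `|q x - q y| <= e x y) ->
  (forall t, q (p t) = 1) -> q z = 0 ->
  (forall s t, mdist s t <= e (p s) (p t)) ->
  isom_embeds [set: T] (fun s t => (mdist s t)%:E) (BMet R X) (@sup_dist R X).
Proof.
move=> [e0 exx esym etri econt] eK TD D0 DK qe qp qz pe.
pose f t x s := Num.max 0 (mdist t s - e x (p s)).
pose F t x := sup (range (f t x)).
(* The factor [2] makes [G] constant on [q >= 1/2], the region where [F t] may be nonzero. *)
pose G x := K * Num.min 1 (2 * q x).
pose H t x := G x + F t x.
pose P t x y := Num.max (e x y) `|H t x - H t y|.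
have fD t x s : f t x s <= D.
  by rewrite ge_max D0 lerBlDr (le_trans (TD t s))// lerDl.
have F0 t x : 0 <= F t x.
  by apply: le_trans (le_sup_range t (fD t x)); rewrite le_max lexx.
have Fe t x y : `|F t x - F t y| <= e x y.
  apply: (sup_range_dist t (fD t x) (fD t y)) => s.
  have := etri x y (p s); have := etri y x (p s); rewrite (esym y x).
  rewrite /f ler_norml; move: (e0 x y).
  by case: (leP 0 (_ - e x _)); case: (leP 0 (_ - e y _)); lra.
have Ft t s x : `|F t x - F s x| <= mdist t s.
  apply: (sup_range_dist t (fD t x) (fD s x)) => r.
  have := metric_triangle t s r; have := metric_triangle s t r.
  rewrite (metric_sym s t) /f ler_norml; move: (mdist_ge0 t s).
  by case: (leP 0 (mdist t r - _)); case: (leP 0 (mdist s r - _)); lra.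
have Fp t s : F t (p s) = mdist t s.
  apply/eqP; rewrite eq_le; apply/andP; split.
    apply: (sup_range_le t) => r; rewrite ge_max mdist_ge0/=.
    by have := metric_triangle t s r; have := pe s r; lra.
  apply: le_trans (le_sup_range s (fD t (p s))).
  by rewrite /f exx subr0 le_max lexx orbT.
(* Such an [x] is at [e]-distance at least [K / 2 >= D] from every [p s]. *)
have F_eq0 t x : q x <= 1 / 2 -> F t x = 0.
  move=> qx; apply/eqP; rewrite eq_le F0 andbT.
  apply: (sup_range_le t) => s; rewrite ge_max lexx/=.
  have := qe x (p s); rewrite qp ler0_norm; last lra.
  have : K * (1 / 2) <= K * - (q x - 1) by apply: ler_wpM2l; lra.
  by have := TD t s; lra.
have G_eq x : 1 / 2 <= q x -> G x = K.
  by move=> qx; rewrite /G min_l ?mulr1//; lra.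
have Ge x y : `|G x - G y| <= 2 * e x y.
  apply: (@le_trans _ _ (2 * (K * `|q x - q y|))); last by rewrite ler_wpM2l.
  rewrite -mulrBr normrM ger0_norm; last lra.
  rewrite mulrCA ler_wpM2l//; first lra.
  have : q x - q y <= `|q x - q y| by exact: ler_norm.
  have : - (q x - q y) <= `|q x - q y| by rewrite -normrN; exact: ler_norm.
  rewrite ler_norml.
  by case: (leP 1 (2 * q x)); case: (leP 1 (2 * q y)); lra.
have P3e t x y : P t x y <= 3 * e x y.
  rewrite ge_max; apply/andP; split; first by have := e0 x y; lra.
  have -> : H t x - H t y = (G x - G y) + (F t x - F t y) by rewrite /H; ring.
  by apply: le_trans (ler_normD _ _) _; have := Ge x y; have := Fe t x y; lra.
have Pc t : cont_pseudometric (P t).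
  split.
  - by move=> x y; rewrite le_max e0.
  - by move=> x; rewrite /P exx subrr normr0 maxxx.
  - by move=> x y; rewrite /P esym distrC.
  - move=> x y w; rewrite ge_max; apply/andP; split.
      by apply: le_trans (etri x y w) _; rewrite lerD// le_max lexx.
    apply: le_trans (ler_distD (H t y) _ _) _.
    by rewrite lerD// le_max lexx orbT.
  - move=> x r r0; have r30 : 0 < r / 3 by lra.
    near=> y; apply: le_lt_trans (P3e t x y) _.
    have : e x y < r / 3 by near: y; exact: econt.
    lra.
have PK t x y : P t x y <= 3 * K.
  by apply: le_trans (P3e t x y) _; rewrite ler_wpM2l.
exists (fun t x y => mdist1 x y + P t x y); split=> [t _|t s _ _].
  exact: BMet_mdist1D (Pc t) (PK t).
have dP x y : (mdist1 x y + P t x y) - (mdist1 x y + P s x y)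
    = P t x y - P s x y by ring.
(* If [q > 1/2] at both points then [G] cancels and [e] dominates; otherwise
   [F] vanishes at one of them, so only one increment of [F] contributes. *)
have PH x y : F t x = 0 -> F s x = 0 -> `|P t x y - P s x y| <= mdist t s.
  move=> tx sx; apply: le_trans (Ft t s y).
  have : `| `|H t x - H t y| - `|H s x - H s y| | <= `|F t y - F s y|.
    apply: le_trans (ler_dist_dist _ _) _; rewrite /H tx sx.
    by rewrite -normrN; have -> : - (G x + 0 - (G y + F t y)
      - (G x + 0 - (G y + F s y))) = F t y - F s y by ring.
  by apply: le_trans; exact: ler_dist_maxr.
apply: sup_dist_fin => [x y|b bts].
  rewrite dP; case: (leP (q x) (1 / 2)) => qx.
    by apply: PH; exact: F_eq0.
  case: (leP (q y) (1 / 2)) => qy.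
    have Psym r : P r x y = P r y x by rewrite /P esym distrC.
    by rewrite !Psym; apply: PH; exact: F_eq0.
  have Pe r : P r x y = e x y.
    rewrite /P /H !G_eq ?ltW//; apply/max_l.
    by have -> : K + F r x - (K + F r y) = F r x - F r y by ring.
  by rewrite !Pe subrr normr0 mdist_ge0.
(* At this pair the increment of [H r] is [K + mdist r s], which dominates [e <= K]. *)
exists (p s), z; rewrite dP.
have Ppz r : P r (p s) z = K + mdist r s.
  have -> : P r (p s) z = Num.max (e (p s) z) `|K + mdist r s|.
    rewrite /P /H Fp (F_eq0 r z); last lra.
    rewrite (G_eq (p s)); last by rewrite qp; lra.
    by rewrite /G qz mulr0 min_r// mulr0 addr0 subr0.
  have := mdist_ge0 r s; rewrite ger0_norm; last by rewrite addr_ge0 ?mdist_ge0//; lra.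
  by move=> ?; rewrite max_r//; have := eK (p s) z; lra.
rewrite !Ppz mdistxx addr0 (_ : _ - K = mdist t s); last ring.
by rewrite ger0_norm ?mdist_ge0.
Unshelve. all: by end_near. Qed.

(** * Non-compact spaces *)

Lemma lipschitz_continuous (R : realType) (X : topologicalType)
    (P : X -> X -> R) (f : X -> R) :
  cont_pseudometric P -> (forall x y, `|f x - f y| <= P x y) -> continuous f.
Proof.
move=> [_ _ _ _ Pc] fP x; apply/cvgrPdist_lt => e e0; near=> y.
by apply: le_lt_trans (fP x y) _; near: y; exact: Pc.
Unshelve. all: by end_near. Qed.

Lemma cont_pseudometric_scale (R : realType) (X : metricType R) (k : R) :
  0 < k -> cont_pseudometric (fun x y : X => k * mdist x y).
Proof.
move=> k0; split.
- by move=> x y; rewrite mulr_ge0 ?mdist_ge0// ltW.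
- by move=> x; rewrite mdistxx mulr0.
- by move=> x y; rewrite metric_sym.
- by move=> x y z; rewrite -mulrDr ler_wpM2l ?metric_triangle// ltW.
- move=> x e e0; apply/nbhs_ballP; exists (e / k); first by rewrite /= divr_gt0.
  by move=> y; rewrite ballEmdist /= ltr_pdivlMr// mulrC.
Qed.

Lemma cont_pseudometric_comp (R : realType) (X : topologicalType) (h : X -> R) :
  continuous h -> cont_pseudometric (fun x y : X => `|h x - h y|).
Proof.
move=> hc; split=> //.
- by move=> x; rewrite subrr normr0.
- by move=> x y; rewrite distrC.
- by move=> x y z; exact: ler_distD.
- by move=> x e e0; move/cvgrPdist_lt: (hc x); exact.
Qed.

(** The constant is [3 = 1 + 1/2 + 1/2 + 1]: if centres are [3] apart, no ball of radius [1/2] meets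
    two of their unit balls. *)
Definition unbounded_pm (R : realType) (X : topologicalType) (P : X -> X -> R) :=
  forall s : seq X, exists y, forall x, x \in s -> 3 <= P x y.

Lemma unbounded_pm_seq (R : realType) (X : topologicalType) (P : X -> X -> R) :
  unbounded_pm P -> (forall x y, P x y = P y x) ->
  exists a : nat -> X, forall n m, n != m -> 3 <= P (a n) (a m).
Proof.
move=> /choice[next nextP] Psym.
(* [L n] lists the first [n] terms, latest first; [next] stays away from all of them. *)
pose L := fix L n := if n is m.+1 then next (L m) :: L m else [::].
have aL n m : (n < m)%N -> next (L n) \in L m.
  elim: m => [//|m IH]; rewrite ltnS leq_eqVlt => /predU1P[->|/IH nm].
    exact: mem_head.
  by rewrite inE nm orbT.
exists (fun n => next (L n)) => n m; rewrite neq_ltn => /orP[nm|mn].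
  by apply: nextP; exact: aL.
by rewrite Psym; apply: nextP; exact: aL.
Qed.

(* For an ultrafilter [G] without limit: either some radius [e] has no ball in
   [G], and a multiple of the distance is unbounded; or [G] is Cauchy, and
   [x |-> 1 / lim_G d(x, .)] is continuous and unbounded. *)
Lemma noncompact_unbounded_pm (R : realType) (X : metricType R) :
  ~ compact [set: X] ->
  exists P : X -> X -> R, cont_pseudometric P /\ unbounded_pm P.
Proof.
move=> ncX.
have [G [UG Gncvg]] : exists G : set_system X,
    UltraFilter G /\ forall x : X, ~ (G --> x).
  apply: contrapT => H; apply: ncX; rewrite compact_ultra => G UG _.
  apply: contrapT => nG; apply: H; exists G; split=> // x Gx.
  by apply: nG; exists x.
have PG : ProperFilter G by exact: ultra_proper.
have [[e [e0 Ge]]|] := pselect (exists e : R, 0 < e /\ forall x : X, ~ G (ball x e)).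
  (* The factor turns distance [e] into [3]. The complements of finitely many [e]-balls lie in [G],
     hence have a common point. *)
  exists (fun x y => (3 / e) * mdist x y); split.
    by apply: cont_pseudometric_scale; rewrite divr_gt0.
  move=> s; suff : G [set y | forall x, x \in s -> 3 <= 3 / e * mdist x y].
    by move/filter_ex.
  elim: s => [|x s IH]; first by apply: filterS filterT.
  have : G (~` ball x e) by have [/Ge|] := in_ultra_setVsetC (ball x e) UG.
  apply: filterS2 IH => y /= ys; rewrite ballEmdist /= => /negP.
  rewrite -leNgt => exy w; rewrite inE => /predU1P[->|/ys//].
  by rewrite -mulrA ler_pMr// ler_pdivlMl// mulr1.
move=> /forallNP Gcauchy.
have {}Gcauchy e : 0 < e -> exists x, G (ball x e).
  move=> e0; have /not_andP[//|/existsNP[x /contrapT]] := Gcauchy e.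
  by exists x.
pose S x := [set r : R | G (ball x r)].
(* This is the limit of [mdist x] along [G], positive because [G] does not converge to [x]. *)
pose d x := inf (S x).
have S0 x : S x !=set0.
  have [y Gy] := Gcauchy 1 ltr01; exists (mdist x y + 1) => /=.
  apply: filterS Gy => w; rewrite /= !ballEmdist /= => yw.
  by apply: le_lt_trans (metric_triangle x y w) _; rewrite ltrD2l.
have Spos x : lbound (S x) 0.
  move=> r /= /filter_ex[y]; rewrite ballEmdist /= => xy.
  exact: ltW (le_lt_trans (mdist_ge0 x y) xy).
have hinf x : has_lbound (S x) by exists 0.
have d_gt0 x : 0 < d x.
  have [U [Ux nU]] : exists U, nbhs x U /\ ~ G U.
    by have /existsNP[U /not_implyP] := Gncvg x; exists U.
  have [e /= e0 eU] := (nbhs_ballP _ _).1 Ux.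
  apply: (lt_le_trans e0); apply: lb_le_inf => // r /= Gr.
  rewrite leNgt; apply/negP => re; apply: nU; apply: filterS Gr.
  by move=> y xy; apply: eU; apply: le_ball xy; exact: ltW.
have d_lip x y : `|d x - d y| <= 1 * mdist x y.
  have dle (u v : X) : d u <= d v + mdist u v.
    rewrite -lerBlDr; apply: lb_le_inf => // r /= Gr; rewrite lerBlDr.
    apply: ge_inf => //=; apply: filterS Gr => w; rewrite !ballEmdist /= => vw.
    by apply: le_lt_trans (metric_triangle u v w) _; rewrite addrC ltrD2r.
  have := dle x y; have := dle y x; rewrite (metric_sym y x) ler_norml mul1r.
  lra.
have dc : continuous d.
  exact: lipschitz_continuous (cont_pseudometric_scale X ltr01) d_lip.
pose h x := (d x)^-1.
have hc : continuous h.
  by move=> x; apply: cvgV; [rewrite gt_eqF | exact: dc].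
exists (fun x y => `|h x - h y|); split; first exact: cont_pseudometric_comp.
move=> s; have [M [M0 sM]] : exists M, 0 < M /\ forall x, x \in s -> h x <= M.
  elim: s => [|x s [M [M0 sM]]]; first by exists 1.
  exists (Num.max M (h x)); split; first by rewrite lt_max M0.
  move=> y; rewrite inE => /predU1P[->|/sM yM]; first by rewrite le_max lexx orbT.
  by rewrite le_max yM.
have M3 : 0 < M + 3 by lra.
have [y Gy] : exists y, G (ball y (M + 3)^-1) by apply: Gcauchy; rewrite invr_gt0.
exists y => x /sM xM.
have : M + 3 <= h y.
  by rewrite -(invrK (M + 3)) lef_pV2 ?posrE ?invr_gt0//; exact: ge_inf.
by rewrite distrC => hy; rewrite ger0_norm; lra.
Qed.

Lemma noncompact_bumps (R : realType) (X : metricType R) :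
  ~ compact [set: X] -> exists (g : nat -> X -> R) (a : nat -> X) (z : X),
  [/\ forall n, continuous (g n), forall n x, 0 <= g n x <= 1,
      forall n m, g n (a m) = (n == m)%:R, forall n, g n z = 0 &
      forall x : X, exists N, \forall y \near x, forall n, (N <= n)%N -> g n y = 0].
Proof.
move=> /noncompact_unbounded_pm[P [cP uP]].
have [P0 Pxx Psym Ptri Pc] := cP.
have [a aP] := unbounded_pm_seq uP Psym.
pose g n x := Num.max 0 (1 - P (a n) x).
have g_eq0 n x : 1 <= P (a n) x -> g n x = 0 by move=> ?; apply/max_l; lra.
(* [a 0] is set apart as the common zero, hence the shift. *)
exists (fun n => g n.+1), (fun n => a n.+1), (a 0); split.
- move=> n; apply: lipschitz_continuous cP _ => x y.
  have := Ptri (a n.+1) x y; have := Ptri (a n.+1) y x; rewrite (Psym y x).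
  have := P0 x y; rewrite ler_norml /g.
  by case: (leP 0 (_ - P _ x)); case: (leP 0 (_ - P _ y)); lra.
- by move=> n x; rewrite le_max lexx /= ge_max ler01/=; have := P0 (a n.+1) x; lra.
- move=> n m; have [->|nm] := eqVneq n m; first by rewrite /g Pxx subr0 max_r.
  by apply: g_eq0; have := @aP n.+1 m.+1 nm; lra.
- by move=> n; apply: g_eq0; have := @aP n.+1 0%N isT; lra.
move=> x; have near_small : \forall y \near x, P x y < 1 / 2 by apply: Pc; lra.
(* At most one unit ball around the [a n] meets the [1/2]-ball at [x]; past its index all bumps
   vanish near [x]. *)
have [[n [y [xy any]]]|none] :=
    pselect (exists n y, P x y < 1 / 2 /\ P (a n) y < 1).
  exists n; apply: filterS near_small => w xw m nm; apply: g_eq0.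
  rewrite leNgt; apply/negP => amw.
  have := @aP m.+1 n; rewrite gtn_eqF// => /(_ isT).
  have := Ptri (a m.+1) w (a n); have := Ptri w y (a n); have := Ptri w x y.
  by rewrite (Psym w x) (Psym y (a n)); lra.
exists 0%N; apply: filterS near_small => w xw m _; apply: g_eq0.
by rewrite leNgt; apply/negP => amw; apply: none; exists m.+1, w.
Qed.

(* In [sup_n w n * |g n x - g n y|] every weight has a coefficient at most [1],
   and at the pair (peak of the [n]-th bump, common zero) only the [n]-th term
   survives; hence the sup-distance is the sup-distance of the weights. *)
Lemma noncompact_weighted_metrics (R : realType) (X : metricType R) :
  ~ compact [set: X] -> exists Dm : (nat -> R) -> X -> X -> R,
  [/\ forall w, (forall n, 0 <= w n) -> Met R X (Dm w),
      forall w M, (forall n, 0 <= w n <= M) -> BMet R X (Dm w) &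
      forall w w' (c : R), (forall n, 0 <= w n) -> (forall n, 0 <= w' n) ->
        (forall n, `|w n - w' n| <= c) ->
        (forall b, b < c -> exists n, b < `|w n - w' n|) ->
        sup_dist (Dm w) (Dm w') = c%:E].
Proof.
move=> /noncompact_bumps[g [a [z [gc g01 ga gz gfin]]]].
have gd n x y : `|g n x - g n y| <= 1.
  by rewrite ler_norml; have := g01 n x; have := g01 n y; lra.
have wbnd (w : nat -> R) x y : (forall n, 0 <= w n) ->
    exists M, forall n, w n * `|g n x - g n y| <= M.
  move=> w0; have [N Nx] := gfin x; have [N' N'y] := gfin y.
  (* From [N + N'] on, the bumps vanish at both points; the sum bounds each earlier weight. *)
  exists (\sum_(i < N + N') w i) => n; have [nN|Nn] := ltnP n (N + N').
    apply: (@le_trans _ _ (w n)); first by rewrite ler_piMr.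
    by rewrite (bigD1 (Ordinal nN))//= lerDl sumr_ge0.
  rewrite (nbhs_singleton Nx) ?(nbhs_singleton N'y) ?subrr ?normr0 ?mulr0.
  - exact: sumr_ge0.
  - exact: leq_trans (leq_addl _ _) Nn.
  - exact: leq_trans (leq_addr _ _) Nn.
have wc (w : nat -> R) : (forall n, 0 <= w n) -> cont_pseudometric (sup_pm w g).
  move=> w0; apply: cont_pseudometric_sup_pm => //.
    by move=> x y; exact: wbnd.
  move=> x e e0; have [N Nx] := gfin x; exists N.
  apply: filterS (Nx) => y Ny n Nn.
  by rewrite (nbhs_singleton Nx)// Ny// subrr normr0 mulr0 ltW.
exists (fun w x y => mdist1 x y + sup_pm w g x y); split.
- by move=> w w0; apply: Met_mdist1D; exact: wc.
- move=> w M wM; have w0 n : 0 <= w n by have /andP[] := wM n.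
  apply: (@BMet_mdist1D _ _ _ M); first exact: wc.
  move=> x y; apply: (sup_range_le 0%N) => n.
  by apply: (@le_trans _ _ (w n)); [rewrite ler_piMr|have /andP[] := wM n].
move=> w w' c w0 w'0 wc1 wc2.
apply: sup_dist_fin => [x y|b /wc2[n bn]].
  rewrite (_ : _ - _ = sup_pm w g x y - sup_pm w' g x y); last ring.
  have [M wM] := wbnd w x y w0; have [M' wM'] := wbnd w' x y w'0.
  apply: (sup_range_dist 0%N wM wM') => n.
  rewrite -mulrBl normrM normr_id; apply: le_trans (wc1 n).
  by rewrite ler_piMr.
exists (a n), z.
have pm_az (v : nat -> R) : (forall n, 0 <= v n) -> sup_pm v g (a n) z = v n.
  move=> v0; have vE k : v k * `|g k (a n) - g k z| = v k * (k == n)%:R.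
    by rewrite ga gz subr0 normr_nat.
  have vM k : v k * `|g k (a n) - g k z| <= v n.
    by rewrite vE; case: eqVneq => [->|]; rewrite ?mulr1// mulr0.
  apply/eqP; rewrite eq_le; apply/andP; split; first exact: sup_range_le vM.
  by apply: le_trans (le_sup_range n vM); rewrite vE eqxx mulr1.
by rewrite (_ : _ - _ = w n - w' n)// !pm_az//; ring.
Qed.

Lemma linfty_dist_le (R : realType) (u v : nat -> R) n :
  linfty R u -> linfty R v -> `|u n - v n| <= linfty_dist u v.
Proof.
move=> [M uM] [M' vM].
apply: (@le_sup_range _ _ (fun k => `|u k - v k|) (M + M')) => k.
by apply: le_trans (ler_normB _ _) _; rewrite lerD.
Qed.

Lemma linfty_dist_gt (R : realType) (u v : nat -> R) (b : R) :
  b < linfty_dist u v -> exists n, b < `|u n - v n|.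
Proof.
move=> bu; apply: contrapT => /forallNP H; move: bu; apply/negP; rewrite -leNgt.
by apply: (sup_range_le 0%N) => n; rewrite leNgt; apply/negP; exact: H.
Qed.

(* The weight [u n + k], cut off at [0], recovers [u n] for [k] large enough:
   this copes with weights being nonnegative while [u] is not. *)
Lemma noncompact_linfty (R : realType) (X : metricType R) :
  ~ compact [set: X] ->
  isom_embeds (linfty R) (fun u v => (linfty_dist u v)%:E)
    (Met R X) (@sup_dist R X).
Proof.
move=> /noncompact_weighted_metrics[Dm [DmMet _ DmE]].
(* The default [(0, 0)] is harmless: it merely repeats a weight. *)
pose dec i : nat * nat := odflt (0, 0)%N (unpickle i).
pose w (u : nat -> R) i := Num.max 0 (u (dec i).1 + (dec i).2%:R).
have w0 u i : 0 <= w u i by rewrite le_max lexx.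
exists (fun u => Dm (w u)); split=> [u _|u v lu lv]; first exact: DmMet.
have wuv i : `|w u i - w v i| <= `|u (dec i).1 - v (dec i).1|.
  apply: le_trans (ler_dist_maxr _ _ _) _.
  by rewrite opprD addrACA subrr addr0.
apply: DmE => // [i|b /linfty_dist_gt[n bn]].
  by apply: le_trans (wuv i) _; exact: linfty_dist_le.
have [[M uM] [M' vM]] := (lu, lv).
have [k [Mk M'k]] : exists k : nat, M <= k%:R /\ M' <= k%:R.
  exists (maxn (Num.trunc M).+1 (Num.trunc M').+1).
  split; apply: le_trans (ltW (truncnS_gt _)) _; rewrite ler_nat.
    exact: leq_maxl.
  exact: leq_maxr.
exists (pickle (n, k)); rewrite /w /dec pickleK /=.
have := uM n; have := vM n; rewrite !ler_norml => /andP[? _] /andP[? _].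
rewrite !max_r; [|lra|lra].
by rewrite opprD addrACA subrr addr0.
Qed.

(** * Dense sequences and Frechet's embedding *)

Definition dense_seq (R : realType) (T : metricType R) (s : nat -> T) :=
  forall (t : T) (e : R), 0 < e -> exists n, mdist t (s n) < e.

Lemma mdist_coord_le (R : realType) (T : metricType R) (t r s : T) :
  `|mdist t s - mdist r s| <= mdist t r.
Proof.
rewrite ler_norml; have := metric_triangle t r s; have := metric_triangle r t s.
by rewrite (metric_sym r t); lra.
Qed.

Lemma mdist_coord_gt (R : realType) (T : metricType R) (s : nat -> T)
    (t r : T) (b : R) :
  dense_seq s -> b < mdist t r -> exists n, b < `|mdist t (s n) - mdist r (s n)|.
Proof.
move=> ds btr; have [|n tn] := ds t ((mdist t r - b) / 2); first lra.
exists n; have := metric_triangle t (s n) r; rewrite (metric_sym (s n) r) distrC.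
by have := ler_norm (mdist r (s n) - mdist t (s n)); lra.
Qed.

(** Subtracting the coordinates of [t0] makes the sequences bounded even when [T] is not, and
    preserves their differences. *)
Lemma frechet_linfty (R : realType) (T : metricType R) (s : nat -> T) (t0 : T) :
  dense_seq s -> isom_embeds [set: T] (fun t r => (mdist t r)%:E)
    (linfty R) (fun u v => (linfty_dist u v)%:E).
Proof.
move=> ds; exists (fun t n => mdist t (s n) - mdist t0 (s n)); split=>
  [t _|t r _ _].
  by exists (mdist t t0) => n; exact: mdist_coord_le.
congr (_%:E); have E n : `|mdist t (s n) - mdist t0 (s n)
    - (mdist r (s n) - mdist t0 (s n))| = `|mdist t (s n) - mdist r (s n)|.
  by congr (`|_|); ring.
rewrite /linfty_dist /linfty_norm; under eq_fun do rewrite E.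
apply/eqP; rewrite eq_le; apply/andP; split.
  by apply: (sup_range_le 0%N) => n; exact: mdist_coord_le.
rewrite leNgt; apply/negP => /(mdist_coord_gt ds)[n]; apply/negP; rewrite -leNgt.
apply: (@le_sup_range _ _ (fun k => `|mdist t (s k) - mdist r (s k)|)
    (mdist t r)) => k.
  exact: mdist_coord_le.
Qed.

Lemma isom_embeds_trans (R : realType) (L M N : Type) (A : set L) (B : set M)
    (C : set N) (rho : L -> L -> \bar R) (sigma : M -> M -> \bar R)
    (tau : N -> N -> \bar R) :
  isom_embeds A rho B sigma -> isom_embeds B sigma C tau ->
  isom_embeds A rho C tau.
Proof.
move=> [f [fB fE]] [h [hC hE]]; exists (h \o f); split=> [x Ax|x y Ax Ay] /=.
  by apply/hC/fB.
by rewrite hE ?fE//; exact: fB.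
Qed.

(** The distances [mdist t (s n)] are nonnegative and uniformly bounded, so they serve directly as
    weights; the route through [linfty] uses unbounded weights. *)
Lemma noncompact_bounded_BMet (R : realType) (X T : metricType R)
    (s : nat -> T) :
  ~ compact [set: X] -> bounded_space T -> dense_seq s ->
  isom_embeds [set: T] (fun t r => (mdist t r)%:E) (BMet R X) (@sup_dist R X).
Proof.
move=> /noncompact_weighted_metrics[Dm [_ DmB DmE]] [M TM] ds.
exists (fun t => Dm (fun n => mdist t (s n))); split=> [t _|t r _ _].
  by apply: (DmB _ M) => n; rewrite mdist_ge0 TM.
apply: DmE => [n|n|n|b]; rewrite ?mdist_ge0//; first exact: mdist_coord_le.
exact: mdist_coord_gt.
Qed.

Lemma separable_dense_seq (R : realType) (T : metricType R) (t0 : T) :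
  separable_space T -> exists s : nat -> T, dense_seq s.
Proof.
move=> [S /countable_injP[f finj] dS].
have /choice[s sP] : forall n, exists t,
    (exists2 r, S r & f r = n) -> S t /\ f t = n.
  move=> n; have [[r Sr fr]|no] := pselect (exists2 r, S r & f r = n).
    by exists r.
  by exists t0.
exists s => t e e0; have [r [tr Sr]] : ball t e `&` S !=set0.
  have [U [oU Ut Ue]] : exists U, [/\ open U, U t & U `<=` ball t e].
    exists (ball t e)°; split; [exact: open_interior| |exact: interior_subset].
    exact: nbhsx_ballx.
  have [r [Ur Sr]] := dS U (ex_intro _ t Ut) oU.
  by exists r; split=> //; exact: Ue.
have [Sf ff] : S (s (f r)) /\ f (s (f r)) = f r by apply: sP; exists r.
exists (f r); move: tr; rewrite ballEmdist /=.
by rewrite (finj (s (f r)) r) ?inE.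
Qed.

(** * Totally bounded spaces and Cantor schemes *)

Lemma totally_bounded_net (R : realType) (T : metricType R) (e : R) :
  totally_bounded_space T -> 0 < e ->
  exists s : seq T, forall x, exists2 a, a \in s & mdist a x < e.
Proof.
move=> tbT /tbT[F /finite_seqP[s ->] sP]; exists s => x.
by have [a /= sa] := sP x I; rewrite ballEmdist => ax; exists a.
Qed.

(** Compactness is used in near-covering form along the filter of finite lists ordered by inclusion;
    a large enough list is a net. *)
Lemma compact_totally_bounded (R : realType) (T : metricType R) :
  compact_space T -> totally_bounded_space T.
Proof.
move=> /compact_near_coveringP cT e e0.
pose F := filter_from [set: seq T] (fun s => [set s' : seq T | {subset s <= s'}]).
have FF : Filter F.
  apply: filter_from_filter; first by exists [::].
  move=> s s' _ _; exists (s ++ s') => // w ss'w; split=> x xs; apply: ss'w;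
    by rewrite mem_cat xs ?orbT.
have : \forall s \near F, [set: T] `<=` [set x | exists2 a, a \in s & mdist a x < e].
  apply: (cT (seq T) F (fun s x => exists2 a, a \in s & mdist a x < e)) => x _.
  exists (ball x e, [set s : seq T | {subset [:: x] <= s}]).
    by split; [exact: nbhsx_ballx | exists [:: x]].
  move=> [y s] /= [xy xs]; exists x; first by apply: xs; exact: mem_head.
  by move: xy; rewrite ballEmdist.
move=> [s _ /(_ s)] sT; exists [set` s] => // x _.
have [a sa ax] := sT (fun=> id) x I.
by exists a => //; rewrite ballEmdist.
Qed.

Lemma totally_bounded_bounded (R : realType) (T : metricType R) :
  totally_bounded_space T -> bounded_space T.
Proof.
move=> tbT; have [s sP] := totally_bounded_net tbT ltr01.
have [[t0]|noT] := pselect (inhabited T); last first.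
  by exists 0 => x; exfalso; apply: noT.
have [M sM] : exists M, forall a, a \in s -> mdist t0 a <= M.
  elim: s {sP} => [|a s [M sM]]; first by exists 0.
  exists (Num.max M (mdist t0 a)) => b; rewrite inE => /predU1P[->|/sM bM].
    by rewrite le_max lexx orbT.
  by rewrite le_max bM.
have t0M x : mdist t0 x <= M + 1.
  have [a /sM aM ax] := sP x; have := metric_triangle t0 a x; lra.
exists (2 * (M + 1)) => x y; have := metric_triangle x t0 y.
by rewrite (metric_sym x t0); have := t0M x; have := t0M y; lra.
Qed.

Lemma exists_invS_lt (R : realType) (e : R) : 0 < e -> exists n, n.+1%:R^-1 < e.
Proof.
move=> e0; exists (Num.trunc e^-1).
by rewrite invf_plt ?posrE ?ltr0n//; exact: truncnS_gt.
Qed.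

Lemma totally_bounded_dense_seq (R : realType) (T : metricType R) (t0 : T) :
  totally_bounded_space T -> exists s : nat -> T, dense_seq s.
Proof.
move=> tbT; have /choice[net netP] : forall j : nat, exists s : seq T,
    forall x, exists2 a, a \in s & mdist a x < j.+1%:R^-1.
  by move=> j; apply: totally_bounded_net; rewrite // invr_gt0 ltr0n.
pose dec i : nat * nat := odflt (0, 0)%N (unpickle i).
exists (fun i => nth t0 (net (dec i).1) (dec i).2) => t e /exists_invS_lt[j je].
have [a aj at_] := netP j t; exists (pickle (j, index a (net j))).
by rewrite /dec pickleK /= nth_index// metric_sym (lt_trans at_).
Qed.

(* [sg n t] is the [n]-th bit of the address of [t]: the bits of level [j]
   compare the distances to a finite net with its mesh, and points further
   apart than twice the mesh differ in at least one of them. *)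
Lemma totally_bounded_code (R : realType) (T : metricType R) (K : R) :
  totally_bounded_space T -> 0 < K -> (forall s t : T, 2 * mdist s t <= K) ->
  exists (c : nat -> R) (sg : nat -> T -> bool),
  [/\ forall n, 0 <= c n <= K,
      forall e, 0 < e -> exists N, forall n, (N <= n)%N -> c n <= e &
      forall s t, s != t -> exists2 n, mdist s t <= c n & sg n s != sg n t].
Proof.
move=> tbT K0 TK.
have [[t0]|noT] := pselect (inhabited T); last first.
  exists (fun=> 0), (fun _ _ => true); split.
  - by move=> _; rewrite lexx ltW.
  - by move=> e e0; exists 0%N => n _; exact: ltW.
  - by move=> s; exfalso; apply: noT.
pose r j : R := K / 2 / j.+1%:R.
have r0 j : 0 < r j by rewrite divr_gt0 ?ltr0n//; lra.
(* Slow decay turns the bound [2 * r j] just before separation into [4 * r j.+1], which enters the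
   weight of the separating level. *)
have rS j : r j <= 2 * r j.+1.
  have jj : j.+2%:R <= 2 * j.+1%:R :> R.
    by rewrite -natrM ler_nat mul2n -addnn addSn ltnS leq_addl.
  have : r j.+1 * j.+2%:R <= r j.+1 * (2 * j.+1%:R) by rewrite ler_wpM2l// ltW.
  rewrite [X in X * _ <= _]/r divfK ?pnatr_eq0// => rj.
  by rewrite [r j]/r ler_pdivrMr ?ltr0n//; lra.
have /choice[net netP] : forall j : nat, exists s : seq T,
    forall x, exists2 a, a \in s & mdist a x < r j.
  by move=> j; exact: totally_bounded_net.
pose dec i : nat * nat := odflt (0, 0)%N (unpickle i).
(* Both tests discard junk codes; otherwise infinitely many indices could share a level, and [c]
   need not tend to [0]. *)
pose c i := if (pickle (dec i) == i) && ((dec i).2 < size (net (dec i).1))%N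
  then Num.min K (4 * r (dec i).1) else 0.
pose sg i t := mdist (nth t0 (net (dec i).1) (dec i).2) t < r (dec i).1.
exists c, sg; split.
- move=> n; rewrite /c; case: ifP => _; last by rewrite lexx ltW.
  rewrite ge_min lexx le_min (ltW K0)/= andbT.
  by have := r0 (dec n).1; lra.
- move=> e e0.
  have [J Je] : exists J, 4 * r J <= e.
    have [J Je] := @exists_invS_lt _ (e / (2 * K)) ltac:(by rewrite divr_gt0//; lra).
    exists J; rewrite /r; move: Je; rewrite ltr_pdivlMr; last lra.
    by move: J.+1%:R^-1 => y; lra.
  have rJ j : (J <= j)%N -> r j <= r J.
    move=> Jj; rewrite /r ler_pM2l; last lra.
    by rewrite lef_pV2 ?posrE ?ltr0n// ler_nat ltnS.
  (* All genuine codes of level [j] are below [B j]. *)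
  pose B (j : nat) := \max_(m < size (net j)) (pickle (j, val m)).+1.
  exists (\max_(j < J) B (val j)) => n Nn.
  rewrite /c; case: ifP => [/andP[/eqP npickle nm]|_]; last exact: ltW.
  rewrite ge_min; apply/orP; right; apply: le_trans Je.
  rewrite ler_wpM2l//; apply: rJ; rewrite leqNgt; apply/negP => jJ.
  have nB : (n < B (dec n).1)%N.
    rewrite -[X in (X < _)%N]npickle {1}[dec n]surjective_pairing.
    exact: (leq_bigmax (F := fun m : 'I__ => (pickle (_, val m)).+1) (Ordinal nm)).
  have := leq_bigmax (F := fun j : 'I_J => B (val j)) (Ordinal jJ).
  by move=> /(leq_trans nB)/leq_trans/(_ Nn); rewrite ltnn.
move=> s t st.
have [j0 j0P] : exists j, 2 * r j < mdist s t.
  have st0 : 0 < mdist s t by rewrite mdist_gt0.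
  have [j jst] := exists_invS_lt (divr_gt0 st0 K0).
  by exists j; move: jst; rewrite ltr_pdivlMr// /r; move: j.+1%:R^-1 => y; lra.
(* The first separating level is not [0], since [2 * r 0 = K]. *)
have := ex_minnP (ex_intro (fun j => 2 * r j < mdist s t) _ j0P).
move=> [[|j]] jP jmin.
  by have := TK s t; move: jP; rewrite /r divr1; lra.
have [a aj as_] := netP j.+1 s.
have am : nth t0 (net j.+1) (index a (net j.+1)) = a by exact: nth_index.
exists (pickle (j.+1, index a (net j.+1))); rewrite /c /sg /dec pickleK /= ?eqxx.
  rewrite index_mem aj le_min; apply/andP; split.
    by have := TK s t; have := mdist_ge0 s t; lra.
  have : mdist s t <= 2 * r j.
    by rewrite leNgt; apply/negP => /jmin; rewrite ltnn.
  by have := rS j; lra.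
rewrite am as_; apply/negP => /eqP/esym at_.
have := metric_triangle s a t; rewrite (metric_sym s a).
by move: jP as_ at_; lra.
Qed.

(** Take a cluster point of the filter of sets containing all but countably many points of [A]. If
    [U] met [A] in a countable set, the complement of [U] would be in this filter and would have to
    meet [U]. *)
Lemma condensation_point (X : topologicalType) (A : set X) :
  compact A -> ~ countable A ->
  exists x : X, forall U, nbhs x U -> ~ countable (A `&` U).
Proof.
move=> cA ncA; pose F := [set B : set X | countable (A `\` B)].
have FF : ProperFilter F.
  split; first by rewrite /F /= setD0.
  split; first by rewrite /F /= setDT; exact: countable0.
    move=> B C; rewrite /F /= => cB cC.
    by rewrite setDIr -bigcup2E; apply: bigcup_countable => // -[|[|]].
  by move=> B C BC; apply: sub_countable; apply: subset_card_le; exact: setDS.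
have FA : F A by rewrite /F /= setDv; exact: countable0.
have [x [_ Fx]] := cA F FF FA; exists x => U Ux cAU.
have [|y [nUy Uy]] := Fx (~` U) U _ Ux; last exact: nUy.
by rewrite /F /= setDE setCK.
Qed.

Lemma closed_mdist_le (R : realType) (X : metricType R) (x : X) (r : R) :
  closed [set y | mdist x y <= r] /\ closed [set y | r <= mdist x y].
Proof.
have mc : continuous (mdist x).
  apply: lipschitz_continuous (cont_pseudometric_scale X ltr01) _ => y z.
  rewrite mul1r ler_norml; have := metric_triangle x y z.
  by have := metric_triangle x z y; rewrite (metric_sym z y); lra.
split.
- by apply: (closed_comp (D := [set y | y <= r]));
    [move=> y _; exact: mc|exact: closed_le].
- by apply: (closed_comp (D := [set y | r <= y]));
    [move=> y _; exact: mc|exact: closed_ge].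
Qed.

(** Uncountably many points of [A] lie outside some [e]-ball at a condensation point [x]; they
    condense at some [y], and closed balls of radius [e / 3] separate [x] from [y]. *)
Lemma compact_uncountable_split (R : realType) (X : metricType R) (A : set X) :
  compact [set: X] -> closed A -> ~ countable A ->
  exists BC : set X * set X,
    [/\ closed BC.1 /\ ~ countable BC.1, closed BC.2 /\ ~ countable BC.2,
        BC.1 `<=` A, BC.2 `<=` A & BC.1 `&` BC.2 = set0].
Proof.
move=> cX clA ncA; have cpt (B : set X) : closed B -> compact B.
  by move=> clB; exact: subclosed_compact clB cX _.
have [x xA] := condensation_point (cpt _ clA) ncA.
have [e [e0 ncAe]] : exists e : R, 0 < e /\ ~ countable (A `&` [set y | e <= mdist x y]).
  apply: contrapT => H; apply: ncA.
  have AH : A `<=` [set x] `|` \bigcup_n (A `&` [set y | n.+1%:R^-1 <= mdist x y]).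
    move=> y Ay; have [->|xy] := eqVneq x y; [by left|right].
    have := xy; rewrite -mdist_gt0 => /exists_invS_lt[n ny].
    by exists n => //; split=> //; exact: ltW.
  apply: sub_countable (subset_card_le AH) _.
  rewrite -bigcup2E; apply: bigcup_countable => // -[|[|]] //= _.
  apply: bigcup_countable => // n _; apply: contrapT => nc; apply: H.
  by exists n.+1%:R^-1; split.
have clAe : closed (A `&` [set y | e <= mdist x y]).
  by apply: closedI => //; have [] := closed_mdist_le x e.
have [y yA] := condensation_point (cpt _ clAe) ncAe.
have exy : e <= mdist x y.
  rewrite leNgt; apply/negP => xye; apply: (yA (ball x e)).
    apply/nbhs_ballP; exists (e - mdist x y); first by rewrite /= subr_gt0.
    move=> z; rewrite !ballEmdist /= => yz.
    by have := metric_triangle x y z; lra.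
  rewrite (_ : _ `&` _ = set0) // -subset0 => z [[_ /= ez]].
  by rewrite ballEmdist /= ltNge ez.
pose near_set z := A `&` [set w | mdist z w <= e / 3].
have ncnear z B : B `<=` A -> (forall U, nbhs z U -> ~ countable (B `&` U)) ->
    closed (near_set z) /\ ~ countable (near_set z).
  move=> BA zB; split.
    by apply: closedI => //; have [] := closed_mdist_le z (e / 3).
  move=> cz; apply: (zB (ball z (e / 3))).
    by apply: nbhsx_ballx; lra.
  apply: sub_countable cz; apply: subset_card_le => w [/BA Aw].
  by rewrite ballEmdist /= => /ltW.
exists (near_set x, near_set y); split => //=.
- exact: ncnear xA.
- by apply: ncnear yA => z [].
- by move=> z [].
- by move=> z [].
rewrite -subset0 => z [[_ /= xz] [_ /= yz]].
by have := metric_triangle x z y; rewrite (metric_sym z y); lra.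
Qed.

(* A Cantor scheme of closed uncountable sets, indexed by binary words read
   backwards; [g k] separates the two children at every word of length [k]. *)
Lemma compact_uncountable_independent (R : realType) (X : metricType R) :
  compact [set: X] -> ~ countable [set: X] ->
  exists g : nat -> X -> R,
  [/\ forall k, continuous (g k), forall k x, 0 <= g k x <= 1 &
      forall sg : nat -> bool, exists x, forall k, g k x = (sg k)%:R].
Proof.
move=> cX ncX.
have /choice[sp spP] : forall A : set X, exists BC : set X * set X,
    closed A /\ ~ countable A ->
    [/\ closed BC.1 /\ ~ countable BC.1, closed BC.2 /\ ~ countable BC.2,
        BC.1 `<=` A, BC.2 `<=` A & BC.1 `&` BC.2 = set0].
  move=> A; have [[clA ncA]|nA] := pselect (closed A /\ ~ countable A).
    by have [BC ?] := compact_uncountable_split cX clA ncA; exists BC.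
  by exists (A, A) => /nA.
pose node := fix node (s : seq bool) : set X := if s is b :: s' then
  (if b then (sp (node s')).2 else (sp (node s')).1) else setT.
have nodeP s : closed (node s) /\ ~ countable (node s).
  elim: s => [|b s IH]; first by split=> //; exact: closedT.
  by have [? ? _ _ _] := spP _ IH; case: b.
have node_sub b s : node (b :: s) `<=` node s.
  by have [_ _ ? ? _] := spP _ (nodeP s); case: b.
have node_inj s t x : size s = size t -> node s x -> node t x -> s = t.
  elim: s t => [|b s IH] [|b' t] //= [st] xs xt.
  have est : s = t.
    by apply: IH => //; [apply: (node_sub b)|apply: (node_sub b')].
  congr cons => //; move: xs xt; rewrite -est.
  have [_ _ _ _ dis] := spP _ (nodeP s).
  by case: b b' => -[]//= xs xt; exfalso;
    have : ((sp (node s)).1 `&` (sp (node s)).2) x by []; rewrite dis.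
(* Words of length [k] are finite in number, so both levels are closed and Urysohn's lemma yields
   [g k]. *)
pose level k b := \bigcup_(s in [set: k.-tuple bool]) node (b :: s).
have level_closed k b : closed (level k b).
  apply: closed_bigcup => [|s _]; first exact: finite_finset.
  by have [] := nodeP (b :: s).
have level_dis k : level k false `&` level k true = set0.
  rewrite -subset0 => x [[s _ xs] [t _ xt]].
  by have := node_inj (false :: s) (true :: t) x;
    rewrite /= !size_tuple => /(_ erefl xs xt).
have /choice[g gP] : forall k, exists f : X -> R, [/\ continuous f,
    range f `<=` `[0, 1], f @` level k false `<=` [set 0]
    & f @` level k true `<=` [set 1]].
  move=> k; apply/uniform_separatorP; move: (level_dis k).
  apply: (proj1 (@normal_separatorP R _)) => //.
  by apply: compact_normal => //; exact: metric_hausdorff.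
exists g; split.
- by move=> k; have [] := gP k.
- move=> k x; have [_ g01 _ _] := gP k.
  have /(_ (g k x)) : g k @` setT `<=` `[0, 1] by [].
  by rewrite /= in_itv; apply; exists x.
(* The nodes along the branch [sg] are nonempty, closed and nested; compactness gives a common
   point. *)
move=> sg; pose pre := fix pre n := if n is m.+1 then sg m :: pre m else [::].
have pre_size n : size (pre n) = n by elim: n => //= n ->.
have pre_sub m n : (m <= n)%N -> node (pre n) `<=` node (pre m).
  elim: n => [|n IH]; first by rewrite leqn0 => /eqP->.
  rewrite leq_eqVlt => /predU1P[->//|/IH]; apply: subset_trans.
  exact: node_sub.
pose F := filter_from [set: nat] (node \o pre).
have FF : ProperFilter F.
  apply: filter_from_proper.
    apply: filter_from_filter; first by exists 0%N.
    move=> m n _ _; exists (maxn m n) => // x mnx.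
    by split; apply: pre_sub mnx; [exact: leq_maxl|exact: leq_maxr].
  move=> n _; apply/set0P/eqP => /= n0; have [_] := nodeP (pre n).
  by rewrite n0; apply; exact: countable0.
have [x [_ xF]] := cX F FF (filterT).
have xnode n : node (pre n) x.
  have [+ _] := nodeP (pre n); rewrite closure_id => ->.
  by move: xF; rewrite clusterE; apply; exists n.
exists x => k; have xk : level k (sg k) x.
  exists (Tuple (introT eqP (pre_size k))) => //; exact: (xnode k.+1).
have [_ _ g0 g1] := gP k; case: (sg k) xk => xk.
  by apply: g1; exists x.
by apply: g0; exists x.
Qed.

(* The function [g 0] separates the range of [p] from [z]; the others realize
   the bits of the code. *)
Lemma compact_uncountable_BMet (R : realType) (X T : metricType R) :
  compact [set: X] -> ~ countable [set: X] -> totally_bounded_space T ->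
  isom_embeds [set: T] (fun s t => (mdist s t)%:E) (BMet R X) (@sup_dist R X).
Proof.
move=> cX ncX tbT; have [M TM] := totally_bounded_bounded tbT.
pose D := `|M| + 1; have D0 : 0 < D by rewrite ltr_wpDl.
have TD (s t : T) : mdist s t <= D.
  by apply: le_trans (TM s t) _; rewrite (le_trans (ler_norm M))// lerDl.
have [g [gc g01 gsg]] := compact_uncountable_independent cX ncX.
have K0 : 0 < 2 * D by rewrite mulr_gt0.
have TK (s t : T) : 2 * mdist s t <= 2 * D by rewrite ler_pM2l.
have [c [sg [cK c_lim c_code]]] := totally_bounded_code tbT K0 TK.
(* Index [0] carries the full weight [K = 2 * D] for [q = g 0]; the code bits are shifted by one. *)
pose c' n := if n is m.+1 then c m else 2 * D.
have c'K n : 0 <= c' n <= 2 * D.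
  by case: n => [|n]; [rewrite lexx ltW|exact: cK].
have gd n x y : c' n * `|g n x - g n y| <= c' n.
  have /andP[c'0 _] := c'K n; rewrite ler_piMr// ler_norml.
  by have := g01 n x; have := g01 n y; lra.
have gdK n x y : c' n * `|g n x - g n y| <= 2 * D.
  by apply: le_trans (gd n x y) _; have /andP[] := c'K n.
have e_ge n x y : c' n * `|g n x - g n y| <= sup_pm c' g x y.
  exact: (le_sup_range (f := fun n => c' n * `|g n x - g n y|) n
    (fun n => gdK n x y)).
have ce : cont_pseudometric (sup_pm c' g).
  apply: cont_pseudometric_sup_pm => //.
  - by move=> n; have /andP[] := c'K n.
  - by move=> x y; exists (2 * D) => n; exact: gdK.
  - move=> x e /c_lim[N cN]; exists N.+1; apply: nearW => y [//|n] Nn.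
    by apply: le_trans (gd n.+1 x y) _; exact: cN.
pose bit t k := if k is m.+1 then sg m t else true.
have /choice[p pP] := fun t => gsg (bit t).
have [z zP] := gsg (fun=> false).
apply: (isom_embeds_BMet_coded (e := sup_pm c' g) (q := g 0%N) (K := 2 * D)
  (D := D) (p := p) (z := z)) => //.
- by move=> x y; apply: (sup_range_le 0%N) => n; exact: gdK.
- exact: ltW.
- by move=> x y; exact: (e_ge 0%N).
move=> s t; have [->|/c_code[n stn sgn]] := eqVneq s t.
  by rewrite mdistxx; have [e0 _ _ _ _] := ce; exact: e0.
apply: le_trans stn _; apply: le_trans (e_ge n.+1 (p s) (p t)).
rewrite !pP /=; move: sgn; case: (sg n s) (sg n t) => -[]// _.
  by rewrite subr0 normr1 mulr1.
by rewrite sub0r normrN normr1 mulr1.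
Qed.

(** * Universality of the spaces of metrics *)

Lemma isom_embeds_BMet_Met (R : realType) (X : metricType R) (M : Type)
    (A : set M) (rho : M -> M -> \bar R) :
  isom_embeds A rho (BMet R X) (@sup_dist R X) ->
  isom_embeds A rho (Met R X) (@sup_dist R X).
Proof. by move=> [f [fB fE]]; exists f; split=> // x /fB[]. Qed.

Theorem corollary1p7 (R : realType) (X : metricType R)
    (infX : infinite_set [set: X]) :
  (* (1) *)
  (compact_space X -> ~ countable [set: X] ->
     universal_for (Met R X) (@sup_dist R X) (@totally_bounded_space R))
  /\
  (* (2) *)
  (~ compact_space X ->
     [/\ isom_embeds (linfty R) (fun u v => (linfty_dist u v)%:E)
           (Met R X) (@sup_dist R X),
         universal_for (Met R X) (@sup_dist R X) (@separable_space R) &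
         universal_for (BMet R X) (@sup_dist R X)
           (fun T : metricType R => bounded_space T /\ separable_space T)])
  /\
  (* consequence *)
  (~ compact_space X \/ (compact_space X /\ ~ countable [set: X]) ->
     universal_for (BMet R X) (@sup_dist R X) (@compact_space R)).
Proof.
(* Base points and default values require an inhabited [T]; the empty space embeds vacuously. *)
have empty_ok (T : metricType R) (B : set (X -> X -> R)) :
    (T -> isom_embeds [set: T] (fun s t => (mdist s t)%:E) B (@sup_dist R X)) ->
    isom_embeds [set: T] (fun s t => (mdist s t)%:E) B (@sup_dist R X).
  move=> H; have [[t0]|noT] := pselect (inhabited T); first exact: H.
  by exists (fun _ _ _ => 0); split=> [t|t r] _; exfalso; apply: noT.
split=> [cX ncX T tbT|].
  by apply: isom_embeds_BMet_Met; exact: compact_uncountable_BMet.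
split=> [ncX|[ncX|[cX ncX]] T cT].
- split; first exact: noncompact_linfty.
  + move=> T sT; apply: empty_ok => t0.
    have [s ds] := separable_dense_seq t0 sT.
    exact: isom_embeds_trans (frechet_linfty t0 ds) (noncompact_linfty ncX).
  + move=> T [bT sT]; apply: empty_ok => t0.
    have [s ds] := separable_dense_seq t0 sT.
    exact: noncompact_bounded_BMet ncX bT ds.
- have tbT := compact_totally_bounded cT; apply: empty_ok => t0.
  have [s ds] := totally_bounded_dense_seq t0 tbT.
  exact: noncompact_bounded_BMet ncX (totally_bounded_bounded tbT) ds.
- exact: compact_uncountable_BMet cX ncX (compact_totally_bounded cT).
Qed.
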